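(* Let $G$ be a finite group such that $(G,Z(G))$ is a Camina pair and $(G/Z(G),Z(G/Z(G)))$ is a generalized Camina pair (in this case $Z(G)\subseteq G'$). Let $g\in G'$. Then $$\zeta^{w_2}_G(g)=\begin{cases}\frac{|G|\,[\,|Z(G)|(|G|+|G'|(|Z(G)|-1))+|Z_2(G)|(|G'|-|Z(G)|)\,]}{|G'||Z(G)|} & \text{if } g=1,\\[2pt] \frac{|G|\,[\,|Z(G)|(|G|-|G'|)+|Z_2(G)|(|G'|-|Z(G)|)\,]}{|G'||Z(G)|} & \text{if } 1\ne g\in Z(G),\\[2pt] \frac{|G|(|G|-|Z_2(G)|)}{|G'|} & \text{if } g\in G'\setminus Z(G),\end{cases}$$ and $$\zeta^{w_3}_G(g)=\begin{cases}\frac{|G|^2\,[\,|G||Z(G)|^2+(|G'|-|Z(G)|)(|G|+|Z_2(G)|(|Z(G)|-1))\,]}{|G'||Z(G)|} & \text{if } g=1,\\[2pt] \frac{|G|^2(|G'|-|Z(G)|)(|G|-|Z_2(G)|)}{|G'||Z(G)|} & \text{if } 1\neq g\in Z(G),\\[2pt] 0 & \text{if } g\in G'\setminus Z(G).\end{cases}$$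
   Context: $[a,b]=a^{-1}b^{-1}ab$, $w_2(x_1,x_2)=[x_1,x_2]$, $w_3(x_1,x_2,x_3)=[[x_1,x_2],x_3]$, and $\zeta^{w_n}_G(g)=|\{(a_1,\dots,a_n)\in G^n: w_n(a_1,\dots,a_n)=g\}|$. $Z(G)$ is the center, $Z_2(G)$ is the second center ($Z_2(G)/Z(G)=Z(G/Z(G))$), $G'=[G,G]$. A pair $(G,H)$ is a Camina pair if $1<H<G$ is a normal subgroup of $G$ and $gH\subseteq \mathrm{Cl}_G(g)$ (the conjugacy class of $g$) for every $g\in G\setminus H$. For $N$ normal in a group $K$, $(K,N)$ is a generalized Camina pair if $\chi(g)=0$ for every nonlinear irreducible complex character $\chi$ of $K$ and every $g\in K\setminus N$. *)

(* Defs.v *)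
From mathcomp Require Import all_boot all_algebra all_fingroup all_solvable.
From mathcomp Require Import all_field all_character.

Set Implicit Arguments.
Unset Strict Implicit.
Unset Printing Implicit Defensive.

Import GroupScope.

(* [~ x, y] is x^-1 * y^-1 * x * y, and [~ x, y, z] is [~ [~ x, y], z]. *)
Definition w2 (gT : finGroupType) (a : 2.-tuple gT) : gT :=
  [~ tnth a 0%R, tnth a 1%R].

Definition w3 (gT : finGroupType) (a : 3.-tuple gT) : gT :=
  [~ tnth a 0%R, tnth a 1%R, tnth a 2%R].

Definition zeta (gT : finGroupType) (n : nat) (w : n.-tuple gT -> gT)
    (G : {group gT}) (g : gT) : nat :=
  #|[set a : n.-tuple gT | [forall i, tnth a i \in G] && (w a == g)]|.

Definition camina_pair (gT : finGroupType) (G H : {group gT}) : Prop :=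
  [/\ [set 1] \proper H, H \proper G, H <| G &
      forall g, g \in G :\: H -> g *: H \subset g ^: G].

(* The irreducible complex characters are represented with values in algC, as
   all values of characters of finite groups are algebraic numbers. *)
Definition generalized_camina_pair (gT : finGroupType) (K N : {group gT})
    : Prop :=
  N <| K /\
  forall i : Iirr K, ('chi[K]_i)%R \isn't a linear_char ->
    forall g, g \in K :\: N -> ('chi[K]_i g = 0)%R.

(* Main.v *)
(** Write Z, Z2 for the first two terms of the upper central series of G.
    Second orthogonality turns the generalized Camina condition on G / Z into:
    noncentral classes of G / Z are full cosets of its derived subgroup, which
    forces G' <= Z2. Together with the Camina condition this determines all
    conjugacy classes of G: the class of x is {x}, xZ or xG' according as x is
    in Z, in Z2 \ Z or outside Z2. Hence the number of y with [x, y] = g is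
    known for every x, and the two counts follow by summing over x, respectively
    over the value h = [a1, a2] of the inner commutator, which lies in Z2. *)

Require Import Defs.
From mathcomp Require Import all_boot all_algebra all_fingroup all_solvable.
From mathcomp Require Import all_field all_character.
From mathcomp Require Import ring.

Set Implicit Arguments.
Unset Strict Implicit.
Unset Printing Implicit Defensive.

Import GroupScope GRing.Theory Num.Theory.
Local Open Scope ring_scope.

(** * Conjugacy classes in generalized Camina pairs *)

Lemma class_sub_lcoset_der1 (gT : finGroupType) (G : {group gT}) (x : gT) :
  x \in G -> (x ^: G \subset x *: G^`(1))%g.
Proof.
move=> Gx; apply/subsetP=> _ /imsetP[y Gy ->].
by rewrite mem_lcoset -commgEl mem_commg.
Qed.

(* Only the [#|G : G^`(1)|] linear characters contribute to the second
   orthogonality relation at [g], so [g] has a class of size [#|G^`(1)|]. *)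
Lemma generalized_camina_class (gT : finGroupType) (G N : {group gT}) (g : gT) :
  generalized_camina_pair G N -> g \in G :\: N ->
  (g ^: G = g *: G^`(1))%g.
Proof.
move=> [_ vanish] GNg; have /setDP[Gg _] := GNg.
apply/eqP; rewrite eqEcard class_sub_lcoset_der1 //= card_lcoset.
have: (#|'C_G[g]|%:R = #|G : G^`(1)%g|%:R :> algC)%R.
  have := second_orthogonality_relation g Gg; rewrite class_refl mulr1n => <-.
  rewrite -card_lin_irr -sum1_card natr_sum [RHS]big_mkcond /=.
  apply: eq_bigr => i _; rewrite inE; case: ifPn => [lin_i | nlin_i].
    by rewrite -normCK normC_lin_char // expr1n.
  by rewrite vanish // mul0r.
move/eqP; rewrite eqr_nat => /eqP cardC.
rewrite -index_cent1 -(leq_pmul2l (cardG_gt0 'C_G[g])).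
rewrite Lagrange ?subsetIl // cardC mulnC Lagrange //=; exact: der_sub.
Qed.

(** A noncentral [g] in [G'] would have class [gG' = G'], which contains 1; but only 1 is conjugate
    to 1. *)
Lemma generalized_camina_center_nil2 (gT : finGroupType) (G : {group gT}) :
  generalized_camina_pair G 'Z(G)%G -> G^`(1)%g \subset 'Z(G).
Proof.
move=> hG; apply/subsetP=> g G'g; apply/contraT=> Zg.
have Gg : g \in G by apply: subsetP G'g; apply: der_sub.
have /(generalized_camina_class hG) eqC: g \in G :\: 'Z(G) by rewrite inE Zg.
have : 1%g \in (g ^: G)%g by rewrite eqC mem_lcoset mulg1 groupV.
case/imsetP=> y _ /esym/eqP; rewrite conjg_eq1 => /eqP g1.
by rewrite g1 group1 in Zg.
Qed.

(** * Counting solutions of commutator equations *)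

(** [[x, y] = h] means [x ^ y = x * h], so the solutions [y] form a coset of the centralizer of [x],
    or nothing if [x * h] is not conjugate to [x]. The parameter [D] will be 1, [Z] or [G']. *)
Lemma card_commg_fiber (gT : finGroupType) (G D : {group gT}) (x h : gT) :
  x \in G -> (x ^: G = x *: D)%g ->
  #|[set y in G | [~ x, y]%g == h]|%:R
    = (h \in D)%:R * (#|G|%:R / #|D|%:R) :> rat.
Proof.
move=> Gx eqC.
have -> : [set y in G | [~ x, y]%g == h] = amove 'J G x (x * h)%g.
  apply/setP=> y; rewrite !inE /= commgEl.
  by rewrite -(inj_eq (mulgI x)) mulKVg.
have [Dh | nDh] := boolP (h \in D); last first.
  rewrite mul0r; apply/eqP; rewrite pnatr_eq0 cards_eq0; apply: contraNT nDh.
  case/set0Pn=> y /setIdP[Gy /eqP eq_xh].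
  by rewrite -[h](mulKg x) -mem_lcoset -eqC -eq_xh memJ_class.
have /imsetP[y Gy ->] : (x * h)%g \in (x ^: G)%g.
  by rewrite eqC mem_lcoset mulKg.
rewrite (amove_act 'J x (subsetT G)) // card_rcoset astab1J mul1r.
rewrite -(card_lcoset D x) -eqC -index_cent1 -(Lagrange (subcent1_sub x G)).
by rewrite natrM mulfK // pnatr_eq0 -lt0n.
Qed.

Lemma zeta_w2E (gT : finGroupType) (G : {group gT}) (g : gT) :
  zeta (@w2 gT) G g = (\sum_(x in G) #|[set y in G | [~ x, y]%g == g]|)%N.
Proof.
rewrite /zeta -sum1_card.
under [RHS]eq_bigr => x _ do rewrite -sum1_card.
rewrite pair_big_dep /=.
rewrite (reindex (fun p : gT * gT => [tuple p.1; p.2])) /=.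
  apply: eq_bigl => -[x y]; rewrite !inE /= andbA; congr (_ && _).
  apply/forallP/andP=> [Gxy | [Gx Gy] [[|[|//]] ?] //=].
  by split; [apply: (Gxy 0) | apply: (Gxy 1)].
exists (fun a : 2.-tuple gT => (tnth a 0, tnth a 1)) => [[x y] _ | a _] //.
apply: eq_from_tnth => -[[|[|//]] ?]; rewrite (tnth_nth 1%g) /=;
by congr (tnth a _); apply: val_inj.
Qed.

(** Each pair [(a1, a2)] has as many extensions to a solution as its commutator [h] allows; pairs
    are then grouped by [h]. *)
Lemma zeta_w3E (gT : finGroupType) (G : {group gT}) (g : gT) :
  zeta (@w3 gT) G g
    = (\sum_(h in G^`(1)%g)
         zeta (@w2 gT) G h * #|[set y in G | [~ h, y]%g == g]|)%N.
Proof.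
have -> : zeta (@w3 gT) G g
    = (\sum_(a : 2.-tuple gT | [forall i, tnth a i \in G])
         #|[set y in G | [~ w2 a, y]%g == g]|)%N.
  rewrite /zeta -sum1_card.
  under [RHS]eq_bigr => a _ do rewrite -sum1_card.
  rewrite pair_big_dep /=.
  rewrite (reindex (fun p : 2.-tuple gT * gT =>
                      [tuple tnth p.1 0; tnth p.1 1; p.2])) /=.
    apply: eq_bigl => -[a y]; rewrite !inE /= andbA; congr (_ && _).
    apply/forallP/andP=> [Gay | [/forallP Ga Gy] [[|[|[|//]]] ?] //=];
      [ | exact: Ga | exact: Ga].
      split; last exact: (Gay 2).
      apply/forallP=> -[[|[|//]] lti].
        by have := Gay 0; rewrite (_ : Ordinal lti = 0) //; apply: val_inj.
      by have := Gay 1; rewrite (_ : Ordinal lti = 1) //; apply: val_inj.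
  exists (fun a : 3.-tuple gT => ([tuple tnth a 0; tnth a 1], tnth a 2)).
    move=> [a y] _; congr pair.
    apply: eq_from_tnth => -[[|[|//]] ?];
    by rewrite (tnth_nth 1%g) /=; congr (tnth a _); apply: val_inj.
  move=> a _; apply: eq_from_tnth => -[[|[|[|//]]] ?];
  by rewrite (tnth_nth 1%g) /=; congr (tnth a _); apply: val_inj.
rewrite (partition_big (@w2 gT) [in G^`(1)%g]) /=; last first.
  by move=> a /forallP Ga; rewrite mem_commg.
apply: eq_bigr => h _; rewrite -sum_nat_const; apply: eq_big => [a | a].
  by rewrite inE.
by case/andP=> _ /eqP ->.
Qed.

(** * Conjugacy classes under the two Camina hypotheses *)

Section Camina.

Variables (gT : finGroupType) (G : {group gT}).
Hypothesis hG : camina_pair G 'Z(G)%G.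
Hypothesis hGZ :
  generalized_camina_pair (G / 'Z(G)%g)%G 'Z(G / 'Z(G)%g)%G.

Lemma camina_lcoset_sub_class (x : gT) :
  x \in G :\: 'Z(G) -> (x *: 'Z(G) \subset x ^: G)%g.
Proof. by case: hG => _ _ _; apply. Qed.

(** For any [x] in [G] outside [Z], which exists as [Z] is proper, [xZ] lies in the class of [x],
    hence in [xG']. *)
Lemma camina_center_sub_der1 : 'Z(G) \subset G^`(1)%g.
Proof.
case: hG => _ /properP[_ [x Gx nZx]] _ _.
apply/subsetP=> z Zz; rewrite -(mulKg x z) -mem_lcoset.
apply: subsetP (class_sub_lcoset_der1 Gx) _ _.
apply: subsetP (camina_lcoset_sub_class _) _ _; first exact/setDP.
by rewrite mem_lcoset mulKg.
Qed.

Lemma quotient_ucn2 : ('Z_2(G) / 'Z(G) = 'Z(G / 'Z(G)))%g.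
Proof. by have := ucn_central 1 G; rewrite ucn1. Qed.

Lemma camina_der1_sub_ucn2 : G^`(1)%g \subset 'Z_2(G).
Proof.
have nZG := normal_norm (center_normal G).
have nsZZ2 : 'Z(G) <| 'Z_2(G) by rewrite -[X in X <| _]ucn1 ucn_normalS.
rewrite -(quotientSGK _ (normal_sub nsZZ2)); last first.
  exact: subset_trans (der_sub 1 G) nZG.
by rewrite quotient_ucn2 quotient_der // generalized_camina_center_nil2.
Qed.

(** Written as a coset of the trivial group to fit [card_commg_fiber]. *)
Lemma class_center (x : gT) : x \in 'Z(G) -> (x ^: G = x *: 1%G)%g.
Proof.
case/setIP=> _ cGx; apply/eqP; rewrite eq_sym eqEcard mulg1 sub1set class_refl.
rewrite cards1 -index_cent1 (setIidPl _) ?indexgg //.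
by rewrite sub_cent1.
Qed.

(** The Camina condition gives one inclusion, [[Z2, G] <= Z] the other. *)
Lemma camina_class_ucn2 (x : gT) :
  x \in 'Z_2(G) :\: 'Z(G) -> (x ^: G = x *: 'Z(G))%g.
Proof.
case/setDP=> Z2x nZx; have Gx := subsetP (ucn_sub 2 G) x Z2x.
have GZx : x \in G :\: 'Z(G) by apply/setDP.
apply/eqP; rewrite eqEsubset camina_lcoset_sub_class //= andbT.
apply/subsetP=> _ /imsetP[y Gy ->]; rewrite mem_lcoset -commgEl.
by have := subsetP (ucn_comm 1 G) _ (mem_commg Z2x Gy); rewrite ucn1.
Qed.

(* The class of [x] is a union of cosets of the center by the Camina
   condition, and its image modulo the center is a full coset. *)
Lemma camina_class_outside_ucn2 (x : gT) :
  x \in G :\: 'Z_2(G) -> (x ^: G = x *: G^`(1))%g.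
Proof.
case/setDP=> Gx nZ2x; have nZG := normal_norm (center_normal G).
have nsZZ2 : 'Z(G) <| 'Z_2(G) by rewrite -[X in X <| _]ucn1 ucn_normalS.
have nZx := subsetP nZG x Gx.
apply/eqP; rewrite eqEsubset class_sub_lcoset_der1 //=.
apply/subsetP=> _ /lcosetP[c G'c ->].
have Gc : c \in G by apply: subsetP G'c; apply: der_sub.
have nZc := subsetP nZG c Gc.
(* [Z2] is the full preimage of the center of [G / Z], so [x] stays noncentral there. *)
have KZx : coset 'Z(G) x \in (G / 'Z(G) :\: 'Z(G / 'Z(G)))%g.
  rewrite inE mem_quotient // andbT -quotient_ucn2.
  apply: contra nZ2x => /morphimP[y nZy Z2y /= eqxy].
  have /rcosetP[u Zu ->] := introT (rcoset_kercosetP nZx nZy) eqxy.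
  by rewrite groupM // (subsetP (normal_sub nsZZ2)).
have eqK := generalized_camina_class hGZ KZx.
have : coset 'Z(G) (x * c) \in ((x ^: G) / 'Z(G))%g.
  rewrite quotient_class // eqK morphM // mem_lcoset mulKg.
  by rewrite -[_^`(1)%g]quotient_der // mem_quotient.
(* This [y] is a conjugate of [x] congruent to [x * c] modulo [Z]. It is noncentral too, so its
   class, which is that of [x], absorbs [yZ]. *)
case/morphimP=> y nZy /imsetP[z Gz def_y] eq_xcy.
have : (x * c)%g \in (y *: 'Z(G))%g.
  rewrite -norm_rlcoset //; apply/rcoset_kercosetP=> //; exact: groupM.
have GnZy : y \in G :\: 'Z(G).
  rewrite def_y; apply/setDP; split; first exact: groupJ.
  rewrite memJ_norm ?(subsetP nZG) //.
  by apply: contra nZ2x; apply: subsetP (normal_sub nsZZ2) _.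
move/(subsetP (camina_lcoset_sub_class GnZy)).
by rewrite def_y (class_eqP (memJ_class x Gz)).
Qed.

(** The three summands come from first entries outside [Z2], in [Z2] minus [Z], and in [Z]. *)
Lemma camina_zeta_w2 (h : gT) :
  (zeta (@w2 gT) G h)%:R
    = (h \in G^`(1)%g)%:R * (#|G|%:R / #|G^`(1)%g|%:R)
        * (#|G|%:R - #|'Z_2(G)|%:R)
      + (h \in 'Z(G))%:R * (#|G|%:R / #|'Z(G)|%:R)
        * (#|'Z_2(G)|%:R - #|'Z(G)|%:R)
      + (h == 1%g)%:R * #|G|%:R * #|'Z(G)|%:R :> rat.
Proof.
have sZZ2 : 'Z(G) \subset 'Z_2(G) by have := ucn_subS 1 G; rewrite ucn1.
have sZ2G : 'Z_2(G) \subset G := ucn_sub 2 G.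
have cardD (A B : {set gT}) (c : rat) : A \subset B ->
    \sum_(x in B :\: A) c = c * (#|B|%:R - #|A|%:R).
  move=> sAB; rewrite sumr_const cardsD (setIidPr sAB) -[LHS]mulr_natr.
  by rewrite natrB // subset_leq_card.
rewrite zeta_w2E natr_sum (big_setID 'Z_2(G)) (setIidPr sZ2G) /=.
rewrite (big_setID 'Z(G)) (setIidPr sZZ2) /=.
rewrite [RHS]addrC [in RHS](addrC (_ * (_ - #|_|%:R))) addrA.
congr (_ + _ + _).
- rewrite -mulrA mulrA mulr_natr -sumr_const; apply: eq_bigr => x Zx.
  have [Gx _] := setIP Zx.
  by rewrite (card_commg_fiber _ Gx (class_center Zx)) inE cards1 divr1.
- rewrite -cardD //; apply: eq_bigr => x Z2x.
  apply: card_commg_fiber; last exact: camina_class_ucn2.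
  by case/setDP: Z2x => /(subsetP sZ2G).
rewrite -cardD //; apply: eq_bigr => x GZ2x.
apply: card_commg_fiber; last exact: camina_class_outside_ucn2.
by case/setDP: GZ2x.
Qed.

End Camina.

Theorem theorem3p16 (gT : finGroupType) (G : {group gT})
    (hG : camina_pair G 'Z(G)%G)
    (hGZ : generalized_camina_pair (G / 'Z(G)%g)%G 'Z(G / 'Z(G)%g)%G) :
  'Z(G) \subset G^`(1)%g /\
  (forall g : gT, g \in G^`(1)%g ->
    (zeta (@w2 gT) G g)%:R =
      (if g == 1%g then
         #|G|%:R * (#|'Z(G)|%:R
                      * (#|G|%:R + #|G^`(1)%g|%:R * (#|'Z(G)|%:R - 1))
                    + #|'Z_2(G)|%:R * (#|G^`(1)%g|%:R - #|'Z(G)|%:R))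
           / (#|G^`(1)%g|%:R * #|'Z(G)|%:R)
       else if g \in 'Z(G) then
         #|G|%:R * (#|'Z(G)|%:R * (#|G|%:R - #|G^`(1)%g|%:R)
                    + #|'Z_2(G)|%:R * (#|G^`(1)%g|%:R - #|'Z(G)|%:R))
           / (#|G^`(1)%g|%:R * #|'Z(G)|%:R)
       else
         #|G|%:R * (#|G|%:R - #|'Z_2(G)|%:R) / #|G^`(1)%g|%:R) :> rat
    /\
    (zeta (@w3 gT) G g)%:R =
      (if g == 1%g then
         #|G|%:R ^+ 2 * (#|G|%:R * #|'Z(G)|%:R ^+ 2
                         + (#|G^`(1)%g|%:R - #|'Z(G)|%:R)
                           * (#|G|%:R + #|'Z_2(G)|%:R * (#|'Z(G)|%:R - 1)))
           / (#|G^`(1)%g|%:R * #|'Z(G)|%:R)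
       else if g \in 'Z(G) then
         #|G|%:R ^+ 2 * (#|G^`(1)%g|%:R - #|'Z(G)|%:R)
           * (#|G|%:R - #|'Z_2(G)|%:R)
           / (#|G^`(1)%g|%:R * #|'Z(G)|%:R)
       else 0) :> rat).
Proof.
have cz : (#|'Z(G)|%:R : rat) != 0 by rewrite pnatr_eq0 -lt0n.
have cd : (#|G^`(1)%g|%:R : rat) != 0 by rewrite pnatr_eq0 -lt0n.
have sZG' := camina_center_sub_der1 hG.
have sG'Z2 := camina_der1_sub_ucn2 hGZ.
split=> // g G'g; split.
  rewrite camina_zeta_w2 // G'g.
  have [-> | _] := eqVneq g 1%g.
    by rewrite group1 /=; field; rewrite cz cd.
  by case: ifP => Zg; rewrite /=; field; rewrite ?cz ?cd.
(* A central [h] satisfies [[h, y] = 1] for all [y], so these [h] matter only for [g = 1], and only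
   through their total count. *)
have Z1 : \sum_(h in 'Z(G)) ((zeta (@w2 gT) G h)%:R : rat)
    = #|G|%:R * ((#|G|%:R - #|'Z_2(G)|%:R) * #|'Z(G)|%:R / #|G^`(1)%g|%:R
                 + #|'Z_2(G)|%:R).
  transitivity (\sum_(h in 'Z(G))
      (#|G|%:R / #|G^`(1)%g|%:R * (#|G|%:R - #|'Z_2(G)|%:R)
       + #|G|%:R / #|'Z(G)|%:R * (#|'Z_2(G)|%:R - #|'Z(G)|%:R)
       + (h == 1%g)%:R * #|G|%:R * #|'Z(G)|%:R) : rat).
    apply: eq_bigr => h Zh.
    by rewrite camina_zeta_w2 // Zh (subsetP sZG') // !mul1r.
  rewrite big_split sumr_const /= -!mulr_suml (bigD1 1%g) //= eqxx.
  rewrite big1 => [|h /andP[_ /negPf->]//].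
  by rewrite -[X in X + _]mulr_natr /=; field; rewrite cz cd.
rewrite zeta_w3E natr_sum (big_setID 'Z(G)) (setIidPr sZG') /=.
under eq_bigr => h Zh.
  rewrite natrM (card_commg_fiber (D := 1%G) _ _ (class_center Zh)).
    2: by case/setIP: Zh.
  rewrite cards1 divr1 inE.
  over.
rewrite -mulr_suml Z1.
(* Here [h] lies in [Z2] minus [Z] and has class [hZ]; the summand no longer depends on [h] and
   vanishes unless [g] is in [Z]. *)
under eq_bigr => h.
  case/setDP=> G'h nZh.
  have Z2h : h \in 'Z_2(G) :\: 'Z(G) by rewrite inE nZh (subsetP sG'Z2).
  have Gh := subsetP (ucn_sub 2 G) _ (subsetP sG'Z2 h G'h).
  rewrite natrM (card_commg_fiber g Gh (camina_class_ucn2 hG Z2h)).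
  have nh1 : h != 1%g by apply: contraNneq nZh => ->; apply: group1.
  rewrite camina_zeta_w2 // G'h (negPf nZh) (negPf nh1).
  rewrite !mul0r !addr0 mul1r.
  over.
rewrite sumr_const cardsD (setIidPr sZG') -[X in _ + X]mulr_natr.
rewrite natrB ?subset_leq_card //.
have [-> | _] := eqVneq g 1%g.
  by rewrite group1 /=; field; rewrite cz cd.
by case: ifP => Zg; rewrite /= ?Zg; field; rewrite ?cz ?cd.
Qed.
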